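(* Suppose $X$ is an indecomposable cycle set and $A$ is an $X$-graded $\mathcal{G}(X)$-module with $\gcd(|\mathcal{G}(X)|,|A_x|)=1$ for $x \in X$. Then a twisted extension $X\otimes_\Phi A$ is indecomposable if and only if for any $x_0\in X$ we have $$A_{x_0}=\langle\Phi(x,x_0): x\in X\rangle .$$
   Context: A cycle set is a finite set $X$ with a binary operation $\ast$ such that $(x\ast y)\ast(x\ast z)=(y\ast x)\ast(y\ast z)$ for all $x,y,z\in X$, each map $\sigma_x: y\mapsto x\ast y$ is bijective, and $x\mapsto x\ast x$ is bijective (all cycle sets are assumed finite and nondegenerate). The permutation group is $\mathcal{G}(X)=\langle \sigma_x : x\in X\rangle\leq \mathrm{Sym}(X)$; put $\lambda_x=\sigma_x^{-1}$, and for $g\in\mathcal{G}(X)$ write $\lambda_g(x)$ for the image of $x\in X$ under $g$. $X$ is indecomposable if it has no partition into two nonempty sub-cycle sets; equivalently $\mathcal{G}(X)$ acts transitively on $X$. An $X$-graded $\mathcal{G}(X)$-module is an abelian group $A=\bigoplus_{x\in X}A_x$ with a $\mathcal{G}(X)$-action by automorphisms such that $g\cdot A_x\subseteq A_{\lambda_g(x)}$; $A^{\mathrm{sc}}=\bigsqcup_{x\in X}\{x\}\times A_x$. Given $\Phi:X\times X\to A$ with $\Phi(x,y)\in A_y$ and $\Phi(\lambda_g(x),\lambda_g(y))=g\cdot\Phi(x,y)$ for all $x,y\in X$, $g\in\mathcal{G}(X)$, the twisted extension $X\otimes_\Phi A$ is the cycle set on $A^{\mathrm{sc}}$ with operation $(x,a)\ast(y,b)=(x\ast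 y,\lambda_x^{-1}\cdot(b+\Phi(x,y)))$, together with the projection $(x,a)\mapsto x$ to $X$. Angle brackets denote the generated (additive) subgroup. *)

(* Defs.v *)
From HB Require Import structures.
From mathcomp Require Import all_boot all_order all_algebra all_fingroup.

Set Implicit Arguments.
Unset Strict Implicit.
Unset Printing Implicit Defensive.

Import GroupScope GRing.Theory.

HB.mixin Record isCycleSet X of Finite X := {
  csop : X -> X -> X;
  csop_cycle : forall x y z : X,
    csop (csop x y) (csop x z) = csop (csop y x) (csop y z);
  csop_bij : forall x : X, bijective (csop x);
  csop_sq_bij : bijective (fun x : X => csop x x)
}.

#[short(type="cycleSetType")]
HB.structure Definition CycleSet := { X of isCycleSet X & Finite X }.

(* The carrier is finite, so a subset closed under the operation is a
   (nondegenerate) cycle set: both injectivity conditions restrict to it. *)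
Definition sub_cycle_set (X : cycleSetType) (Y : {set X}) : Prop :=
  forall x y : X, x \in Y -> y \in Y -> csop x y \in Y.

Definition indecomposable (X : cycleSetType) : Prop :=
  ~ exists Y Z : {set X},
      [/\ Y != set0, Z != set0, Y :|: Z = [set: X] & Y :&: Z = set0] /\
      (sub_cycle_set Y /\ sub_cycle_set Z).

Definition sigma (X : cycleSetType) (x : X) : {perm X} :=
  perm (bij_inj (csop_bij x)).

Definition lambda (X : cycleSetType) (x : X) : {perm X} := (sigma x)^-1.

Definition perm_group (X : cycleSetType) : {group {perm X}} :=
  <<[set sigma x | x : X]>>%G.

(* The product of permutations is (g * h) x = h (g x), so that a left action of
   the permutation group for the composition of maps is a (right) action in the
   sense of the library: [gm_act a g] is g . a.
   The group structure on a finite zmodule is the additive one. *)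
Record graded_module (X : cycleSetType) := GradedModule {
  gm_sort :> finZmodType;
  gm_comp : X -> {group gm_sort};
  gm_act : groupAction (perm_group X) [set: gm_sort];
  gm_dsum : \big[dprod/1]_(x : X) gm_comp x = [set: gm_sort];
  gm_graded : forall (g : {perm X}) (x : X) (a : gm_sort),
    g \in perm_group X -> a \in gm_comp x -> gm_act a g \in gm_comp (g x)
}.

Record twist (X : cycleSetType) (A : graded_module X) := Twist {
  twist_fun :> X -> X -> A;
  twist_mem : forall x y : X, twist_fun x y \in gm_comp A y;
  twist_equiv : forall (x y : X) (g : {perm X}), g \in perm_group X ->
    twist_fun (g x) (g y) = gm_act A (twist_fun x y) g
}.

(* The carrier is the disjoint union of the sets {x} * A_x, whatever Phi is. *)
Record twisted_ext (X : cycleSetType) (A : graded_module X) (Phi : twist A) :=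
  TwistedExt {
    te_val :> X * A;
    te_mem : te_val.2 \in gm_comp A te_val.1
  }.

HB.instance Definition _ (X : cycleSetType) (A : graded_module X)
  (Phi : twist A) := [isSub for @te_val X A Phi].
HB.instance Definition _ (X : cycleSetType) (A : graded_module X)
  (Phi : twist A) := [Finite of twisted_ext Phi by <:].

Definition te_proj (X : cycleSetType) (A : graded_module X) (Phi : twist A)
  (u : twisted_ext Phi) : X := (te_val u).1.

Lemma sigmaE (X : cycleSetType) (x y : X) : sigma x y = csop x y.
Proof. by rewrite permE. Qed.

Lemma sigma_mem (X : cycleSetType) (x : X) : sigma x \in perm_group X.
Proof. by apply: mem_gen; apply: imset_f. Qed.

Lemma lambdaV_mem (X : cycleSetType) (x : X) :
  (lambda x)^-1 \in perm_group X.
Proof. by rewrite invgK sigma_mem. Qed.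

Lemma sigma_cycle (X : cycleSetType) (x y : X) :
  sigma x * sigma (csop x y) = sigma y * sigma (csop y x).
Proof. by apply/permP=> z; rewrite !permM !sigmaE csop_cycle. Qed.

Lemma gm_actD (X : cycleSetType) (A : graded_module X) (g : {perm X})
  (a b : A) : g \in perm_group X ->
  gm_act A (a + b)%R g = (gm_act A a g + gm_act A b g)%R.
Proof.
move=> Gg; rewrite -!FinRing.zmodMgE.
by apply: (gactM (gm_act A) Gg); rewrite inE.
Qed.

Definition ext_op_val (X : cycleSetType) (A : graded_module X) (Phi : twist A)
  (p q : X * A) : X * A :=
  (csop p.1 q.1, gm_act A (q.2 + Phi p.1 q.1)%R (lambda p.1)^-1).

Lemma ext_op_subproof (X : cycleSetType) (A : graded_module X) (Phi : twist A)
  (u v : twisted_ext Phi) :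
  (ext_op_val Phi (val u) (val v)).2
    \in gm_comp A (ext_op_val Phi (val u) (val v)).1.
Proof.
case: u v => [[x a] /= xa] [[y b] /= yb].
have -> : csop x y = (lambda x)^-1 y by rewrite invgK sigmaE.
apply: gm_graded; first exact: lambdaV_mem.
by rewrite -FinRing.zmodMgE groupM ?twist_mem.
Qed.

Definition ext_op (X : cycleSetType) (A : graded_module X) (Phi : twist A)
  (u v : twisted_ext Phi) : twisted_ext Phi :=
  TwistedExt Phi (ext_op_subproof u v).

Lemma ext_op_cycle (X : cycleSetType) (A : graded_module X) (Phi : twist A)
  (u v w : twisted_ext Phi) :
  ext_op (ext_op u v) (ext_op u w) = ext_op (ext_op v u) (ext_op v w).
Proof.
apply: val_inj; case: u v w => [[x a] /= _] [[y b] /= _] [[z c] /= _].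
rewrite /ext_op_val /= csop_cycle; congr (_, _).
rewrite !invgK -!sigmaE !twist_equiv ?sigma_mem // -!gm_actD ?sigma_mem //.
rewrite -!actMin ?sigma_mem // !sigmaE sigma_cycle.
by rewrite -!GRing.addrA [(Phi x z + _)%R]GRing.addrC.
Qed.

Lemma ext_op_bij (X : cycleSetType) (A : graded_module X) (Phi : twist A)
  (u : twisted_ext Phi) : bijective (ext_op u).
Proof.
apply: injF_bij => v w /(congr1 val); case: u v w => [[x a] /= xa] [[y b] yb].
move=> [[z c] zc] /= [/(bij_inj (csop_bij x)) eyz].
by subst y => /act_inj /addIr ebc; apply: val_inj; rewrite /= ebc.
Qed.

Lemma ext_op_sq_bij (X : cycleSetType) (A : graded_module X) (Phi : twist A) :
  bijective (fun u : twisted_ext Phi => ext_op u u).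
Proof.
apply: injF_bij => v w /(congr1 val); case: v w => [[y b] yb] [[z c] zc] /=.
move=> [/(bij_inj csop_sq_bij) eyz].
by subst y => /act_inj /addIr ebc; apply: val_inj; rewrite /= ebc.
Qed.

HB.instance Definition _ (X : cycleSetType) (A : graded_module X)
  (Phi : twist A) :=
  isCycleSet.Build (twisted_ext Phi)
    (@ext_op_cycle X A Phi) (@ext_op_bij X A Phi) (@ext_op_sq_bij X A Phi).

(* Main.v *)
Require Import Defs.
From mathcomp Require Import all_boot all_order all_algebra all_fingroup.
From mathcomp Require Import cyclic.

(** The operation of the extension is affine over that of [X].  Start from the
    identity permutation and iterate [shift x : g |-> g * sigma (g x)].  Feeding
    the resulting left translations to [(y, b)] gives the points
    [(g_k y, g_k . (b + k Phi(x, y)))].  The maps [shift x] commute pairwise,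
    and the group they generate is transitive on the permutation group [G];
    being abelian, it acts regularly there, so [g_k = 1] for [k = #|G|].  Hence
    every invariant subset of the extension is stable under
    [(y, b) |-> (y, b + #|G| Phi(x, y))], and by coprimality under
    [(y, b) |-> (y, b + Phi(x, y))].  Conversely, the points [(y, b)] with [b]
    in the subgroup generated by the [Phi(x, y)] form an invariant subset. *)

Set Implicit Arguments.
Unset Strict Implicit.
Unset Printing Implicit Defensive.

Import GroupScope GRing.Theory.

(** By finiteness, a subset stable under all left translations has a stable complement, so a proper
    one gives a decomposition. Conversely, in a decomposition a translation by a point of [Z]
    permutes [Z], hence preserves its complement [Y]. *)
Lemma indecomposableP (X : cycleSetType) :
  indecomposable X <->
  (forall Y : {set X}, Y != set0 ->
     (forall x y, y \in Y -> csop x y \in Y) -> Y = setT).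
Proof.
split=> [indX Y Y0 stabY | H [Y [Z [[Y0 Z0 YZT YZ0] [sY sZ]]]]].
  apply/eqP/contraT=> YT; case: indX; exists Y, (~: Y); split.
    split=> //; last by rewrite setICr.
      by apply: contra YT => /eqP YC0; rewrite -[Y]setCK YC0 setC0.
    by rewrite setUCr.
  split=> [x y _ yY | x y _]; first exact: stabY.
  (* [sigma x] permutes the finite set [Y], hence its complement. *)
  have imY : [set csop x z | z in Y] = Y.
    apply/eqP; rewrite eqEcard card_imset ?leqnn ?andbT; last first.
      exact: bij_inj (csop_bij x).
    by apply/subsetP=> _ /imsetP [z zY ->]; apply: stabY.
  rewrite !inE; apply: contra; rewrite -{1}imY => /imsetP [z zY].
  by move/(bij_inj (csop_bij x)) ->.
have ZE : Z = ~: Y.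
  apply/setP=> z; have := in_setT z; rewrite -YZT inE => zU.
  have := in_set0 z; rewrite -YZ0 !inE.
  by case: (z \in Y) zU => //= ->.
suff YT : Y = setT by rewrite ZE YT setCT eqxx in Z0.
apply: H => // x y yY; have [xY | xY] := boolP (x \in Y); first exact: sY.
have xZ : x \in Z by rewrite ZE inE.
have imZ : [set csop x z | z in Z] = Z.
  apply/eqP; rewrite eqEcard card_imset ?leqnn ?andbT; last first.
    exact: bij_inj (csop_bij x).
  by apply/subsetP=> _ /imsetP [z zZ ->]; apply: sZ.
apply/contraT => xyY.
have: csop x y \in Z by rewrite ZE inE.
rewrite -imZ => /imsetP [z zZ] /(bij_inj (csop_bij x)) yz.
by move: zZ; rewrite -yz ZE inE yY.
Qed.

(** * Commuting shifts and the orbit of the identity *)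

Section Shift.

Variable X : cycleSetType.
Implicit Types (x y : X) (g : {perm X}).

Definition shift_fun x g : {perm X} := g * sigma (g x).

(* [shift_fun x g] sends [x] to [g x * g x], so injectivity of the square map
   recovers [g x], and then [g]. *)
Lemma shift_fun_inj x : injective (shift_fun x).
Proof.
move=> g h e; have gh : g x = h x.
  apply: (bij_inj (@csop_sq_bij X)).
  by have := congr1 (fun p : {perm X} => p x) e; rewrite !permM !sigmaE.
by move: e; rewrite /shift_fun gh => /mulIg.
Qed.

Definition shift x : {perm {perm X}} := perm (@shift_fun_inj x).

Lemma shiftE x g : shift x g = g * sigma (g x).
Proof. by rewrite permE. Qed.

(** One composite sends [g] to [g * sigma (g x) * sigma (csop (g x) (g y))], and the cycle set
    identity makes this symmetric in [x] and [y]. *)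
Lemma shift_commute x y : commute (shift x) (shift y).
Proof.
apply/permP=> g; rewrite !permM !shiftE !permM !sigmaE -!mulgA.
by rewrite sigma_cycle.
Qed.

Lemma shift_perm_group x g : g \in perm_group X -> shift x g \in perm_group X.
Proof. by move=> Gg; rewrite shiftE groupM ?sigma_mem. Qed.

Definition shift_group : {group {perm {perm X}}} :=
  <<[set shift x | x : X]>>%G.

Lemma mem_shift x : shift x \in shift_group.
Proof. by apply: mem_gen; apply: imset_f. Qed.

Lemma shift_group_abelian : abelian shift_group.
Proof.
rewrite abelian_gen abelianE; apply/subsetP=> _ /imsetP [x _ ->].
by apply/centP=> _ /imsetP [y _ ->]; apply: shift_commute.
Qed.

(** In a finite group every element of a generated subgroup is a product of generators without
    inverses, so induction on words suffices. *)
Lemma perm_group_sub (S : {set {perm X}}) :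
  1 \in S -> (forall g x, g \in S -> g * sigma x \in S) ->
  perm_group X \subset S.
Proof.
move=> S1 SM; apply/subsetP=> g /gen_prodgP [n [c sc ->]].
elim: n c sc => [|n IH] c sc; first by rewrite big_ord0.
rewrite big_ord_recr /=; have /imsetP [x _ ->] := sc ord_max.
by apply: SM; apply: IH => i.
Qed.

Lemma orbit_shift1 : orbit 'P shift_group 1 = perm_group X.
Proof.
apply/eqP; rewrite eqEsubset; apply/andP; split; last first.
  apply: perm_group_sub => [|g x]; first exact: orbit_refl.
  (* Right multiplication of [g] by [sigma x] is a shift whose index depends on [g]. *)
  have -> : g * sigma x = shift (g^-1 x) g by rewrite shiftE permKV.
  move=> gO; apply: (@orbit_trans _ _ 'P%act _ _ g _ _ gO).
  exact: (mem_orbit 'P%act g (mem_shift (g^-1 x))).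
suff acts : [acts shift_group, on perm_group X | 'P].
  by rewrite acts_sub_orbit ?group1.
rewrite gen_subG; apply/subsetP=> _ /imsetP [x _ ->].
rewrite !inE; apply/subsetP=> g Gg; rewrite inE /= apermE.
exact: shift_perm_group.
Qed.

Lemma shift_expg_card x : (shift x ^+ #|perm_group X|) 1 = 1.
Proof.
rewrite -orbit_shift1 card_orbit.
set S := 'C_shift_group[1 | 'P].
have nS : S <| shift_group.
  by rewrite -sub_abelian_normal ?shift_group_abelian ?subsetIl.
(* The quotient by the stabilizer [S] has the length of the orbit as its order, and this power kills
   every coset. *)
have /setIP [_ /astab1P] : shift x ^+ #|shift_group : S| \in S.
  rewrite -card_quotient ?normal_norm //.
  have xN : shift x \in 'N(S) by rewrite (subsetP (normal_norm nS)) ?mem_shift.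
  rewrite coset_idr ?groupX // morphX // expg_cardG //.
  by rewrite mem_quotient // mem_shift.
by rewrite /= apermE.
Qed.

End Shift.

(** * Invariant subsets of the extension and their fibres *)

Section Extension.

Variables (X : cycleSetType) (A : graded_module X) (Phi : twist A).

Definition twist_span (y : X) : {group A} := <<[set Phi x y | x : X]>>%G.

Lemma mem_twist_span (x y : X) : Phi x y \in twist_span y.
Proof. by apply: mem_gen; apply: imset_f. Qed.

Lemma twist_span_sub (y : X) : twist_span y \subset gm_comp A y.
Proof.
by rewrite gen_subG; apply/subsetP=> _ /imsetP [x _ ->]; apply: twist_mem.
Qed.

Lemma twist_span_act (g : {perm X}) (y : X) (a : A) :
  g \in perm_group X -> a \in twist_span y -> gm_act A a g \in twist_span (g y).
Proof.
move=> Gg; pose S := [set c : A | gm_act A c g \in twist_span (g y)].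
have gS : group_set S.
  apply/group_setP; split=> [|b c]; rewrite !inE.
    by rewrite (gact1 (gm_act A) Gg) group1.
  by move=> Sb Sc; rewrite FinRing.zmodMgE gm_actD // -FinRing.zmodMgE groupM.
suff /subsetP sS : twist_span y \subset Group gS by move/sS; rewrite inE.
rewrite gen_subG; apply/subsetP=> _ /imsetP [x _ ->].
by rewrite inE -twist_equiv // mem_twist_span.
Qed.

Lemma twist_spanP_of_indecomposable :
  indecomposable (twisted_ext Phi) ->
  forall y : X, gm_comp A y :=: twist_span y.
Proof.
move=> /indecomposableP indE y; apply/eqP; rewrite eqEsubset twist_span_sub andbT.
pose Y := [set u : twisted_ext Phi | (val u).2 \in twist_span (val u).1].
have YT : Y = setT.
  apply: indE => [|u v].
    apply/set0Pn; exists (@TwistedExt X A Phi (y, 1) (group1 _)).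
    by rewrite inE /= group1.
  rewrite !inE /= => Yv; rewrite invgK -sigmaE.
  apply: twist_span_act; first exact: sigma_mem.
  by rewrite -FinRing.zmodMgE groupM // mem_twist_span.
apply/subsetP=> a Aa.
have : @TwistedExt X A Phi (y, a) Aa \in Y by rewrite YT inE.
by rewrite inE.
Qed.

Section InvariantSet.

Variable Y : {set twisted_ext Phi}.
Hypothesis stabY : forall u v, v \in Y -> csop u v \in Y.

Definition fibre (y : X) : {set A} :=
  [set b | [exists u in Y, val u == (y, b)]].

Lemma fibreP (y : X) (b : A) :
  reflect (exists2 u, u \in Y & val u = (y, b)) (b \in fibre y).
Proof.
rewrite inE; apply: (iffP exists_inP) => [[u uY /eqP]|[u uY uE]]; exists u => //.
exact/eqP.
Qed.

Lemma fibre_sigma (x y : X) (b : A) :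
  b \in fibre y -> gm_act A (b + Phi x y)%R (sigma x) \in fibre (sigma x y).
Proof.
case/fibreP=> v vY vE; apply/fibreP.
(* A left translation ignores the second component of the left factor, so zero, written [1],
   serves. *)
exists (csop (@TwistedExt X A Phi (x, 1) (group1 _)) v); first exact: stabY.
by rewrite /= /ext_op_val [te_val v]vE /= invgK sigmaE.
Qed.

(** Translation by [g x] adds [Phi (g x) (g y)], which by equivariance is the image of [Phi x y]
    under [g]; so each step adds one copy of [Phi x y] inside the action. *)
Lemma fibre_shift (x y : X) (b : A) (k : nat) :
  b \in fibre y ->
  let g := (shift x ^+ k) 1 in
  g \in perm_group X /\ gm_act A (b + Phi x y *+ k)%R g \in fibre (g y).
Proof.
move=> yb; elim: k => [|k [Gg IH]] /=.
  by rewrite expg0 !perm1 mulr0n addr0 act1 group1.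
rewrite expgSr permM; set g := (shift x ^+ k) 1 in Gg IH *.
split; first exact: shift_perm_group.
rewrite shiftE permM actMin ?sigma_mem //.
have := fibre_sigma (g x) IH.
by rewrite twist_equiv // -gm_actD // -GRing.addrA -mulrSr.
Qed.

Lemma fibre_twist (x y : X) (b : A) :
  coprime #|perm_group X| #|gm_comp A y| ->
  b \in fibre y -> (b + Phi x y)%R \in fibre y.
Proof.
move=> cop yb; set n := #|perm_group X| in cop; set m := #|gm_comp A y| in cop.
(* Being 0 modulo [n], this [k] brings the shift back to the identity; being 1 modulo [m], it fixes
   [Phi x y]. *)
pose k := chinese n m 0 1.
have shiftk : (shift x ^+ k) 1 = 1.
  have /dvdnP [j ->] : n %| k.
    by rewrite /dvdn chinese_modl // mod0n.
  rewrite mulnC expgM; elim: j => [|j IH]; first by rewrite expg0 perm1.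
  by rewrite expgS permM shift_expg_card.
have Phik : (Phi x y *+ k = Phi x y)%R.
  rewrite -FinRing.zmodXgE -(expg_mod _ (expg_cardG (twist_mem Phi x y))).
  by rewrite chinese_modr // expg_mod ?expg1 // expg_cardG // twist_mem.
by have [_] := fibre_shift x k yb; rewrite shiftk perm1 act1 Phik.
Qed.

Lemma fibre_full (y : X) :
  coprime #|perm_group X| #|gm_comp A y| -> gm_comp A y :=: twist_span y ->
  fibre y != set0 -> gm_comp A y \subset fibre y.
Proof.
move=> cop AE /set0Pn [b yb].
(* The translations preserving the fibre form a submonoid, hence by finiteness a subgroup; it
   contains every [Phi x y]. *)
pose S := [set c : A | [forall a in fibre y, (a + c)%R \in fibre y]].
have gS : group_set S.
  apply/group_setP; split=> [|c d]; rewrite !inE.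
    by apply/forall_inP=> a ya; rewrite addr0.
  move=> /forall_inP Sc /forall_inP Sd; apply/forall_inP=> a ya.
  by rewrite FinRing.zmodMgE GRing.addrA Sd ?Sc.
have sS : gm_comp A y \subset Group gS.
  rewrite AE gen_subG; apply/subsetP=> _ /imsetP [x _ ->]; rewrite inE.
  by apply/forall_inP=> a; apply: fibre_twist.
have Ab : b \in gm_comp A y.
  by have /fibreP [u _ uE] := yb; have := te_mem u; rewrite [te_val u]uE.
apply/subsetP=> a Aa.
have : (b^-1 * a)%g \in Group gS by rewrite (subsetP sS) // groupM ?groupV.
rewrite inE => /forall_inP /(_ b yb).
by rewrite -FinRing.zmodMgE mulKVg.
Qed.

End InvariantSet.

Lemma indecomposable_of_twist_span :
  indecomposable X ->
  (forall y : X, coprime #|perm_group X| #|gm_comp A y|) ->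
  (forall y : X, gm_comp A y :=: twist_span y) ->
  indecomposable (twisted_ext Phi).
Proof.
move=> /indecomposableP indX cop AE; apply/indecomposableP=> Y Y0 stabY.
(* The projection of [Y] to [X] is invariant, so no fibre is empty. *)
have fT : [set y | fibre Y y != set0] = setT.
  apply: indX => [|x y].
    have /set0Pn [u uY] := Y0; apply/set0Pn; exists (val u).1; rewrite inE.
    apply/set0Pn; exists (val u).2; apply/fibreP; exists u => //.
    exact: surjective_pairing.
  rewrite !inE => /set0Pn [b yb]; apply/set0Pn; rewrite -sigmaE.
  by eexists; apply: (fibre_sigma stabY x yb).
apply/setP=> u; rewrite [RHS]inE.
have : (val u).1 \in [set y | fibre Y y != set0] by rewrite fT inE.
rewrite inE => /(fibre_full stabY (cop _) (AE _)) /subsetP /(_ _ (te_mem u)).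
case/fibreP=> v vY vE; suff -> : u = v by [].
by apply: val_inj; rewrite vE -surjective_pairing.
Qed.

End Extension.

Theorem theorem3p5 (X : cycleSetType) (A : graded_module X) (Phi : twist A)
  (X_indec : indecomposable X)
  (cop : forall x : X, coprime #|perm_group X| #|gm_comp A x|) :
  indecomposable (twisted_ext Phi) <->
  (forall x0 : X, gm_comp A x0 :=: <<[set Phi x x0 | x : X]>>%g).
Proof.
split; first exact: twist_spanP_of_indecomposable.
exact: indecomposable_of_twist_span.
Qed.
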